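(* For every $\varepsilon>0$ there exists $C>0$ such that the following holds. Let $G$ be a connected graph on vertex set $[n]$, let $R\sim G(n,\varepsilon/n)$ and $G^*=G\cup R$. Then asymptotically almost surely the diameter of $G^*$ is at most $C\log n$.
   Context: $G(n,p)$ denotes the binomial random graph on $[n]$ with each pair an edge independently with probability $p$; $G\cup R$ is the graph on $[n]$ with edge set the union of those of $G$ and $R$. Asymptotically almost surely means with probability tending to $1$ as $n\to\infty$, for an arbitrary sequence of such graphs $G=G_n$. *)

(* Defs.v *)
From HB Require Import structures.
From Stdlib Require Import Reals ClassicalDescription.
From mathcomp Require Import all_boot.

Set Implicit Arguments.
Unset Strict Implicit.
Unset Printing Implicit Defensive.

(* Unordered pairs {i,j} of [n] = 'I_n, represented as (i,j) with i < j. *)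
Definition upair (n : nat) : predArgType :=
  {e : 'I_n * 'I_n | ltn (nat_of_ord e.1) (nat_of_ord e.2)}.

Definition simple_graph (n : nat) (g : rel 'I_n) : Prop :=
  symmetric g /\ irreflexive g.

Definition connected_graph (n : nat) (g : rel 'I_n) : Prop :=
  forall u v : 'I_n, connect g u v.

Definition graph_of_edges (n : nat) (S : {set upair n}) : rel 'I_n :=
  fun u v => [exists e in S, (val e == (u, v)) || (val e == (v, u))].

Definition graph_union (n : nat) (g h : rel 'I_n) : rel 'I_n :=
  fun u v => g u v || h u v.

Definition dist_le (n : nat) (g : rel 'I_n) (u v : 'I_n) (d : R) : Prop :=
  exists s : seq 'I_n, path g u s /\ last u s = v /\ Rle (INR (size s)) d.

(* diam(g) <= d (for a disconnected graph the diameter is infinite). *)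
Definition diam_le (n : nat) (g : rel 'I_n) (d : R) : Prop :=
  forall u v : 'I_n, dist_le g u v d.

Definition gnp_weight (n : nat) (p : R) (S : {set upair n}) : R :=
  Rmult (Rpow_def.pow p #|S|) (Rpow_def.pow (Rminus 1 p) (subn #|{: upair n}| #|S|)).

Definition gnp_prob (n : nat) (p : R) (A : {set upair n} -> Prop) : R :=
  \big[Rplus/R0]_(S : {set upair n})
     (if excluded_middle_informative (A S) then gnp_weight p S else R0).

(* Main.v *)
From HB Require Import structures.
Require Import Defs.
From Stdlib Require Import Reals Lra ClassicalDescription.
From mathcomp Require Import all_boot zify_ssreflect.

(* By Sekanina's theorem the cube of a connected graph has a Hamiltonian path.
   Cutting it into intervals of constant size k gives cells of G-diameter O(k),
   and between cells R is a random graph of average degree about eps * k, a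
   large constant.  Start from l ~ 2 ln n consecutive cells near a vertex u and
   explore R in layers of new cells.  While less than a constant fraction of the
   cells is reached, only edges not yet examined matter for the next layer, so a
   Chernoff bound doubles the layer except with probability exp(-2l) <= n^-4;
   hence l steps reach a constant fraction of the cells.  Finally, a union bound
   over pairs of sets of cells (only 4^(n/k) of them) shows that any two large
   disjoint sets of cells are joined by an edge of R. *)

Set Implicit Arguments.
Unset Strict Implicit.
Unset Printing Implicit Defensive.

(* zify_ssreflect rebinds the key R to ring_scope. *)
Delimit Scope R_scope with R.

(** * Expectation over a binomial random subset *)

HB.instance Definition _ := Monoid.isComLaw.Build R R0 Rplus
  (fun x y z => esym (Rplus_assoc x y z)) Rplus_comm Rplus_0_l.
HB.instance Definition _ := Monoid.isComLaw.Build R R1 Rmult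
  (fun x y z => esym (Rmult_assoc x y z)) Rmult_comm Rmult_1_l.
HB.instance Definition _ := Monoid.isMulLaw.Build R R0 Rmult Rmult_0_l Rmult_0_r.
HB.instance Definition _ := Monoid.isAddLaw.Build R Rmult Rplus
  Rmult_plus_distr_r Rmult_plus_distr_l.

Definition indic (b : bool) : R := if b then R1 else R0.

Lemma indic_ge0 b : (0 <= indic b)%R.
Proof. case: b => /=; lra. Qed.

Lemma sumR_le (I : Type) (r : seq I) (P : pred I) (F G : I -> R) :
  (forall i, P i -> (F i <= G i)%R) ->
  (\big[Rplus/R0]_(i <- r | P i) F i <= \big[Rplus/R0]_(i <- r | P i) G i)%R.
Proof.
move=> FG; elim/big_rec2: _ => [|i x y Pi]; first lra.
by have := FG i Pi; lra.
Qed.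

Lemma sumR_const (I : finType) (P : pred I) (a : R) :
  \big[Rplus/R0]_(i | P i) a = (INR #|P| * a)%R.
Proof.
rewrite big_const; elim: #|P| => [|m IH] /=; first by lra.
rewrite IH -/(INR m.+1) S_INR; lra.
Qed.

Lemma sumR_le_const (I : finType) (F : I -> R) a :
  (forall i, (F i <= a)%R) -> (\big[Rplus/R0]_i F i <= INR #|I| * a)%R.
Proof. by move=> Fa; rewrite -sumR_const; apply: sumR_le. Qed.

Lemma prodR_const (I : finType) (P : pred I) (a : R) :
  \big[Rmult/R1]_(i | P i) a = pow a #|P|.
Proof. by rewrite big_const; elim: #|P| => [|m IH] //=; rewrite IH. Qed.

Section Expectation.
Variables (T : finType) (p : R).
Hypothesis p01 : (0 <= p <= 1)%R.
Implicit Types (S F : {set T}) (f g : {set T} -> R).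

Definition weight S : R := \big[Rmult/R1]_e (if e \in S then p else (1 - p)%R).

Definition esp f : R := \big[Rplus/R0]_S (weight S * f S)%R.

(** Measurability with respect to the coordinates in [F]; independence below means dependence on
    complementary coordinate sets. *)
Definition depends_on (U : Type) F (f : {set T} -> U) :=
  forall S S', S :&: F = S' :&: F -> f S = f S'.

Lemma weight_ge0 S : (0 <= weight S)%R.
Proof.
rewrite /weight; elim/big_rec: _ => [|e x _ x0]; first lra.
by case: ifP => _; apply: Rmult_le_pos; lra.
Qed.

Lemma eq_esp f g : f =1 g -> esp f = esp g.
Proof. by move=> fg; apply: eq_bigr => S _; rewrite fg. Qed.

Lemma esp_le f g : (forall S, (f S <= g S)%R) -> (esp f <= esp g)%R.
Proof.
move=> fg; apply: sumR_le => S _; apply: Rmult_le_compat_l => //.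
exact: weight_ge0.
Qed.

Lemma espZ a f : esp (fun S => a * f S)%R = (a * esp f)%R.
Proof.
by rewrite /esp big_distrr; apply: eq_bigr => S _ /=; ring.
Qed.

Lemma esp_sum (I : finType) (P : pred I) (f : I -> {set T} -> R) :
  esp (fun S => \big[Rplus/R0]_(i | P i) f i S) =
  \big[Rplus/R0]_(i | P i) esp (f i).
Proof.
rewrite /esp exchange_big /=; apply: eq_bigr => S _.
by rewrite big_distrr.
Qed.

Lemma espD f g : esp (fun S => f S + g S)%R = (esp f + esp g)%R.
Proof.
by rewrite /esp -big_split; apply: eq_bigr => S _ /=; ring.
Qed.

(** Expanding a product over [e] of two-term sums gives one summand per subset [S], namely the
    elements where the first term is chosen. *)
Lemma esp_prod (a b : T -> R) :
  esp (fun S => \big[Rmult/R1]_e (if e \in S then a e else b e)) =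
  \big[Rmult/R1]_e (p * a e + (1 - p) * b e)%R.
Proof.
rewrite bigA_distr; apply: eq_bigr => S _; rewrite /weight -big_split /=.
by apply: eq_bigr => e _; case: ifP.
Qed.

Lemma esp1 : esp (fun=> R1) = R1.
Proof.
have := esp_prod (fun=> R1) (fun=> R1); rewrite [RHS]big1 => [E|e _]; last ring.
by rewrite -[RHS]E; apply: eq_esp => S; rewrite big1 // => e _; case: ifP.
Qed.

Lemma esp_const a : esp (fun=> a) = a.
Proof.
have := espZ a (fun=> R1); rewrite esp1 Rmult_1_r => E.
by rewrite -[RHS]E; apply: eq_esp => S; ring.
Qed.

Lemma esp_le1 f : (forall S, (f S <= 1)%R) -> (esp f <= 1)%R.
Proof. by move=> f1; have := esp_le f1; rewrite esp1. Qed.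

Lemma esp_ge0 f : (forall S, (0 <= f S)%R) -> (0 <= esp f)%R.
Proof.
move=> f0; rewrite /esp; elim/big_rec: _ => [|S x _ x0]; first lra.
by apply: Rplus_le_le_0_compat => //; apply: Rmult_le_pos => //; apply: weight_ge0.
Qed.

Lemma esp_disjoint F : esp (fun S => indic [disjoint S & F]) = pow (1 - p) #|F|.
Proof.
have := esp_prod (fun e => indic (e \notin F)) (fun=> R1).
rewrite (bigID (mem F)) /=.
rewrite (eq_bigr (fun=> 1 - p)%R) => [|e ->]; last by rewrite /=; ring.
rewrite prodR_const [X in (_ * X)%R]big1 => [|e ->]; last by rewrite /=; ring.
rewrite Rmult_1_r => <-; apply: eq_esp => S.
have [dSF|] := boolP [disjoint S & F].
  rewrite big1 // => e _; case: ifP => // eS.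
  by rewrite (disjointFr dSF eS).
rewrite -setI_eq0 => /set0Pn[e /setIP[eS eF]].
by rewrite (bigD1 e) //= eS eF /= Rmult_0_l.
Qed.

Definition weight_on F S : R :=
  \big[Rmult/R1]_(e in F) (if e \in S then p else (1 - p)%R).

Lemma weight_onS F S : weight_on F (S :&: F) = weight_on F S.
Proof. by apply: eq_bigr => e eF; rewrite inE eF andbT. Qed.

Lemma setU_splitK F (A B : {set T}) : A \subset F -> B \subset ~: F ->
  (A :|: B) :&: F = A /\ (A :|: B) :&: ~: F = B.
Proof.
move=> /subsetP AF /subsetP BF; split; apply/setP=> e; rewrite !inE;
  have := AF e; have := BF e; rewrite !inE;
  case: (e \in A); case: (e \in B); case: (e \in F) => //= h1 h2;
  by [have := h1 isT | have := h2 isT].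
Qed.

Lemma sum_set_split F (h : {set T} -> R) :
  \big[Rplus/R0]_S h S =
  \big[Rplus/R0]_(A : {set T} | A \subset F) \big[Rplus/R0]_(B : {set T} | B \subset ~: F) h (A :|: B).
Proof.
rewrite pair_big /= [RHS](reindex (fun S => (S :&: F, S :&: ~: F))) /=.
  apply: eq_big => [S|S _]; first by rewrite !subsetIr.
  by rewrite -setIUr setUCr setIT.
exists (fun AB : {set T} * {set T} => AB.1 :|: AB.2) => [S _|[A B]] /=.
  by rewrite -setIUr setUCr setIT.
rewrite inE /= => /andP[AF BF].
by have [-> ->] := setU_splitK AF BF.
Qed.

Lemma esp_split F f g : depends_on F f -> depends_on (~: F) g ->
  esp (fun S => f S * g S)%R =
  (\big[Rplus/R0]_(A : {set T} | A \subset F) (weight_on F A * f A) *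
   \big[Rplus/R0]_(B : {set T} | B \subset ~: F) (weight_on (~: F) B * g B))%R.
Proof.
move=> df dg; rewrite /esp (sum_set_split F) big_distrl; apply: eq_bigr => A AF.
rewrite big_distrr; apply: eq_bigr => B BF /=.
have [EA EB] := setU_splitK AF BF.
have -> : weight (A :|: B) = (weight_on F A * weight_on (~: F) B)%R.
  have -> : weight_on F A = weight_on F (A :|: B) by rewrite -{1}EA weight_onS.
  have -> : weight_on (~: F) B = weight_on (~: F) (A :|: B).
    by rewrite -{1}EB weight_onS.
  rewrite /weight (bigID (mem F)) /=; congr Rmult.
  by rewrite [RHS]/weight_on; apply: eq_bigl => e; rewrite inE.
rewrite (df (A :|: B) A) ?EA ?(setIidPl AF) //.
by rewrite (dg (A :|: B) B) ?EB ?(setIidPl BF) //; ring.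
Qed.

(** Splitting each [S] along [F] factors the sum into two marginals. Taking [f] or [g] to be 1
    expresses [esp f] and [esp g] through the same marginals, and the two total marginal masses,
    whose product is 1, cancel. *)
Lemma esp_indep F f g : depends_on F f -> depends_on (~: F) g ->
  esp (fun S => f S * g S)%R = (esp f * esp g)%R.
Proof.
move=> df dg.
have d1 F' : depends_on F' (fun=> R1) by [].
have := esp_split (d1 F) (d1 (~: F)).
under eq_esp do rewrite Rmult_1_r; rewrite esp1 => E1.
have := esp_split (d1 F) dg; under eq_esp do rewrite Rmult_1_l; move=> ->.
have := esp_split df (d1 (~: F)); under eq_esp do rewrite Rmult_1_r; move=> ->.
rewrite (esp_split df dg) Rmult_assoc -(Rmult_assoc _ _ (\big[_/_]_(_ | _) _)).
by rewrite (Rmult_comm (\big[_/_]_(B : {set T} | B \subset ~: F) _)) -E1 Rmult_1_l.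
Qed.

Lemma depends_on_sub (U : Type) F F' (f : {set T} -> U) :
  F \subset F' -> depends_on F f -> depends_on F' f.
Proof.
move=> FF' df S S' E; apply: df.
by rewrite -(setIidPr FF') !setIA E.
Qed.

Lemma esp_indep_prod (I : finType) (O : {set I}) (F : I -> {set T})
    (f : I -> {set T} -> R) :
  (forall i, depends_on (F i) (f i)) ->
  (forall i j, i \in O -> j \in O -> i != j -> [disjoint F i & F j]) ->
  esp (fun S => \big[Rmult/R1]_(i in O) f i S) = \big[Rmult/R1]_(i in O) esp (f i).
Proof.
move=> df dF; rewrite -big_enum /=.
under eq_esp do rewrite -big_enum /=.
have sO : {subset enum O <= O} by move=> i; rewrite mem_enum.
elim: (enum O) (enum_uniq O) sO => [_ _|i s IH /= /andP[iNs us] sO].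
  by under eq_esp do rewrite big_nil; rewrite big_nil esp1.
under eq_esp do rewrite big_cons; rewrite big_cons -IH //; last first.
  by move=> j js; apply: sO; rewrite inE js orbT.
rewrite (esp_indep (df i)) //.
move=> S S' E; apply: eq_big_seq => j js.
have dji : [disjoint F j & F i].
  apply: dF; rewrite ?sO ?mem_head ?inE ?js ?orbT //.
  by apply: contraNneq iNs => <-.
by apply: (depends_on_sub _ (df j)) E; rewrite -disjoints_subset.
Qed.

End Expectation.

(** * Hamiltonian paths in the cube of a connected graph *)

Section Walks.
Variables (V : finType) (g : rel V).
Implicit Types (u v w : V) (A B : {set V}).

Definition walk u v (d : nat) :=
  exists s, [/\ path g u s, last u s = v & size s <= d].

Lemma walk0 u d : walk u u d.
Proof. by exists [::]. Qed.

Lemma walk1 u v : g u v -> walk u v 1.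
Proof. by move=> guv; exists [:: v]; rewrite /= guv. Qed.

Lemma walk_trans v u w d e : walk u v d -> walk v w e -> walk u w (d + e).
Proof.
move=> [s [ps <- sd]] [t [pt <- te]]; exists (s ++ t).
by rewrite cat_path ps pt last_cat size_cat leq_add.
Qed.

Lemma walk_le u v d e : d <= e -> walk u v d -> walk u v e.
Proof. by move=> de [s [ps ls sd]]; exists s; rewrite (leq_trans sd). Qed.

Hypothesis g_sym : symmetric g.

Lemma walk_sym u v d : walk u v d -> walk v u d.
Proof.
move=> [s [ps <- sd]]; exists (rev (belast u s)); split.
- by rewrite rev_path; under eq_path do rewrite g_sym.
- by case: s {ps sd} => //= x s; rewrite rev_cons last_rcons.
- by rewrite size_rev size_belast.
Qed.

Definition near1 u v := (u == v) || g u v.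
(** Adjacency in the cube of [g], with loops: each of the three moves may stay put. *)
Definition near3 u v := [exists a, exists b, [&& near1 u a, near1 a b & near1 b v]].

Lemma near1_sym : symmetric near1.
Proof. by move=> u v; rewrite /near1 eq_sym g_sym. Qed.

Lemma near3_sym : symmetric near3.
Proof.
suff H u v : near3 u v -> near3 v u by move=> u v; apply/idP/idP; apply: H.
move=> /existsP[a /existsP[b /and3P[ua ab bv]]].
apply/existsP; exists b; apply/existsP; exists a.
by rewrite near1_sym bv near1_sym ab near1_sym ua.
Qed.

Lemma near3_walk u v : near3 u v -> walk u v 3.
Proof.
have W x y : near1 x y -> walk x y 1.
  by case/orP => [/eqP-> | /walk1]; first exact: walk0.
move=> /existsP[a /existsP[b /and3P[/W ua /W ab /W bv]]].
exact: walk_trans ua (walk_trans ab bv).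
Qed.

(* Ending next to u as well is what lets tours of two adjacent pieces be glued. *)
Definition cube_tour B u :=
  exists s, [/\ path near3 u s, uniq (u :: s), u :: s =i B & near1 u (last u s)].

(** Follow the tour of [A] from [u], then that of [B] backwards. The junction goes through [u] and
    [w], hence at most three edges, and the new tour ends at [w], a neighbour of [u]. *)
Lemma cube_tourU A B u w : [disjoint A & B] -> g u w ->
  cube_tour A u -> cube_tour B w -> cube_tour (A :|: B) u.
Proof.
move=> dAB guw [s [ps us sA ls]] [t [pt ut tB lt]].
exists (s ++ rev (w :: t)).
have uw x y : near1 x u -> near1 w y -> near3 x y.
  move=> xu wy; apply/existsP; exists u; apply/existsP; exists w.
  by rewrite xu wy /near1 guw orbT.
split.
- rewrite cat_path ps lastI rev_rcons /= uw 1?near1_sym // 1?near1_sym //=.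
  by rewrite rev_path; under eq_path do rewrite near3_sym.
- rewrite -cat_cons cat_uniq us rev_uniq ut andbT /=.
  apply/hasPn => x; rewrite mem_rev tB => xB; rewrite /= sA.
  by rewrite (disjointFl dAB).
- by move=> x; rewrite -cat_cons mem_cat mem_rev sA tB inE.
- by rewrite last_cat rev_cons last_rcons /near1 guw orbT.
Qed.

(** Strong induction on the size of [A]. For a neighbour [w] of [u] in [A], take the component [C]
    of [w] in [A] without [u], then the component of [u] in [A] without [C], and glue their tours
    along the edge [u w]. Closure under [g] makes the result the whole component of [u] in [A]. *)
Lemma cube_tour_closed A u : u \in A -> exists B,
  [/\ B \subset A, u \in B, cube_tour B u &
      forall x y, x \in B -> y \in A -> g x y -> y \in B].
Proof.
have [N] := ubnP #|A|; elim: N A u => // N IH A u cA uA.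
have [/existsP[w /and3P[wA wu guw]] | /existsPn nw] :=
  boolP [exists w, [&& w \in A, w != u & g u w]]; last first.
  exists [set u]; split; rewrite ?sub1set ?inE //.
    exists [::]; split => //=; last by rewrite /near1 eqxx.
    by move=> x; rewrite !inE.
  move=> x y /set1P -> yA guy; rewrite inE; have := nw y.
  by rewrite yA guy andbT /= negbK.
have [cA1 cCA] : #|A :\ u| < N /\ (#|A| = #|A :\ u|.+1).
  by have := cardsD1 u A; rewrite uA; move: cA; lia.
have [|C [CA wC tC clC]] := IH (A :\ u) w cA1; first by rewrite !inE wu.
have CA' : C \subset A by apply: subset_trans CA (subsetDl _ _).
have cA2 : #|A :\: C| < N.
  have := cardsID C A; rewrite (setIidPr CA').
  have : 0 < #|C| by apply/card_gt0P; exists w.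
  by move: cA; lia.
have uC : u \notin C by apply/negP => /(subsetP CA); rewrite !inE eqxx.
have [|B [BA uB tB clB]] := IH (A :\: C) u cA2; first by rewrite inE uC.
have dBC : [disjoint B & C].
  rewrite disjoints_subset; apply/subsetP => x /(subsetP BA).
  by rewrite !inE => /andP[].
exists (B :|: C); split.
- by rewrite subUset CA' (subset_trans BA) ?subsetDl.
- by rewrite inE uB.
- exact: cube_tourU guw tB tC.
move=> x y xBC yA gxy; rewrite inE; have [//|yC] := boolP (y \in C).
  by rewrite orbT.
case/setUP: xBC => [xB|xC]; first by rewrite (clB x) // inE yC.
have [-> | yu] := eqVneq y u; first by rewrite uB.
by rewrite (clC x y) ?inE ?yu // in yC.
Qed.

Lemma cube_tour_connected u : (forall v, connect g u v) -> cube_tour setT u.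
Proof.
move=> cg; have [B [_ uB tB clB]] := cube_tour_closed (in_setT u).
suff -> : [set: V] = B by [].
apply/setP=> v; rewrite inE; have /connectP[s ps ->] := cg v.
elim: s u {cg tB} uB ps => //= w s IH u uB /andP[guw ps].
by apply: IH ps; apply: clB guw.
Qed.

Lemma near3_nth x0 s i d : sorted near3 s -> i + d < size s ->
  walk (nth x0 s i) (nth x0 s (i + d)) (3 * d).
Proof.
move=> /(sortedP x0) ss; elim: d => [|d IH] id; first by rewrite addn0; apply: walk0.
rewrite addnS in id *; rewrite mulnS (addnC 3).
by apply: walk_trans (IH (ltnW id)) (near3_walk (ss _ id)).
Qed.

End Walks.

(* Cells are intervals of k positions on the Hamiltonian path of the cube; the
   last one also takes the remainder and may have up to 2k - 1 vertices. *)
Lemma exists_cells n (g : rel 'I_n) k m :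
  symmetric g -> connected_graph g -> 0 < k -> k * m.+1 <= n < k * m.+2 ->
  exists c : 'I_n -> 'I_m.+1,
    (forall i, k <= #|[set v | c v == i]|) /\
    (forall u v d, c u <= c v + d -> c v <= c u + d ->
       walk g u v (3 * (k * (d + 2)))).
Proof.
move=> gs gc k0 /andP[n1 n2].
have n0 : 0 < n by apply: leq_trans n1; rewrite muln_gt0 k0.
pose u0 : 'I_n := Ordinal n0.
have [s [ps us sT _]] := cube_tour_connected gs (gc u0).
set t := u0 :: s in us sT; have st : sorted (near3 g) t by [].
have tV v : v \in t by rewrite sT inE.
have ct : size t = n.
  by rewrite -(card_uniqP us) (eq_card (B := 'I_n)) ?card_ord.
pose pos v := index v t.
have posn v : pos v < n by rewrite -[ltnRHS]ct index_mem.
pose c v : 'I_m.+1 := inord (minn (pos v %/ k) m).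
have cE v : c v = minn (pos v %/ k) m :> nat by rewrite inordK // ltnS geq_minr.
(* The upper bound has [+ 2] rather than [+ 1] because of the oversized last cell; this is the
   source of [d + 2] in the walk length. *)
have cpos v : k * c v <= pos v < k * (c v + 2).
  rewrite cE; have := posn v; have := divn_eq (pos v) k; have := ltn_pmod (pos v) k0.
  set q := _ %/ _; set r := _ %% _; case: (leqP q m) => qm; nia.
exists c; split => [i | u v d].
  have im : i < m.+1 by [].
  have H j : j < k -> i * k + j < n by move: im n1; nia.
  pose f (j : 'I_k) := nth u0 t (i * k + j).
  have fi : injective f.
    move=> a b /eqP; rewrite nth_uniq ?ct ?H // eqn_add2l => /eqP ab.
    exact: val_inj.
  rewrite -{1}[k]card_ord -(card_imset _ fi).
  apply/subset_leq_card/subsetP => _ /imsetP[j _ ->]; rewrite inE -val_eqE /= cE.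
  by rewrite /pos index_uniq ?ct ?H // divnMDl // divn_small // addn0; apply/eqP/minn_idPl.
wlog le_uv : u v / pos u <= pos v.
  move=> W cuv cvu; have [uv | /ltnW vu] := leqP (pos u) (pos v); first exact: W.
  by apply: walk_sym => //; apply: W.
move=> cuv cvu; rewrite -(nth_index u0 (tV u)) -(nth_index u0 (tV v)).
rewrite -/(pos u) -/(pos v) -(subnKC le_uv).
apply: walk_le (near3_nth _ st _); last by rewrite subnKC // ct posn.
rewrite leq_mul2l /=; have := cpos u; have := cpos v; nia.
Qed.

(** * Layered exploration of the random edges between cells *)

Lemma exp_le x y : (x <= y)%R -> (exp x <= exp y)%R.
Proof. by case=> [/exp_increasing /Rlt_le | ->]; last exact: Rle_refl. Qed.

Lemma exp_mulINR a N : exp (INR N * a) = pow (exp a) N.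
Proof.
elim: N => [|N IH]; first by rewrite Rmult_0_l exp_0.
by rewrite S_INR Rmult_plus_distr_r Rmult_1_l exp_plus IH Rmult_comm.
Qed.

Lemma pow_1sub_exp p N : (0 <= p <= 1)%R -> (pow (1 - p) N <= exp (- (p * INR N)))%R.
Proof.
move=> p01; rewrite Ropp_mult_distr_l Rmult_comm exp_mulINR.
by apply: pow_incr; have := exp_ineq1_le (- p); lra.
Qed.

(** With [y = Rmin 1 x], [exp (- y) <= 1 / (1 + y) <= 1 - y / 2] on the unit interval, so the
    average is at most [1 - y / 4]. This bounds one factor of the Chernoff estimate. *)
Lemma half_exp_le x : (0 <= x)%R -> ((1 + exp (- x)) / 2 <= exp (- (Rmin 1 x / 4)))%R.
Proof.
move=> x0; set y := Rmin 1 x.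
have [y0 y1] : (0 <= y <= 1)%R.
  split; first by apply: Rmin_glb; lra.
  exact: Rmin_l.
have xy : (exp (- x) <= exp (- y))%R.
  by apply: exp_le; have := Rmin_r 1 x; rewrite -/y; lra.
have ey : (exp (- y) * exp y = 1)%R by rewrite -exp_plus Rplus_opp_l exp_0.
have := exp_ineq1_le y; have := exp_pos (- y) => e1 e2.
have : (exp (- y) * (1 + y) <= 1)%R by rewrite -ey; apply: Rmult_le_compat_l; lra.
have := exp_ineq1_le (- (y / 4)); nra.
Qed.

Lemma indic_exists (I : finType) (P : pred I) :
  (indic [exists i, P i] <= \big[Rplus/R0]_i indic (P i))%R.
Proof.
have H (Q : pred I) : (0 <= \big[Rplus/R0]_(i | Q i) indic (P i))%R.
  elim/big_rec: _ => [|i x _ x0]; first lra.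
  by have := indic_ge0 (P i); lra.
have [/existsP[i Pi]|_] := boolP [exists i, P i]; last exact: (H xpredT).
by rewrite (bigD1 i) //= Pi; have := H (fun j => j != i); rewrite /=; lra.
Qed.

Section Edges.
Variable n : nat.
Implicit Types (X Y : {set 'I_n}) (S : {set upair n}).

Definition cross X Y : {set upair n} :=
  [set e | ((val e).1 \in X) && ((val e).2 \in Y)
        || ((val e).1 \in Y) && ((val e).2 \in X)].

Definition touching X : {set upair n} :=
  [set e | ((val e).1 \in X) || ((val e).2 \in X)].

(** Orienting crossing edges to start in [X], by [h], yields every pair of the product; disjointness
    excludes loops and fixes the orientation. *)
Lemma card_cross X Y : [disjoint X & Y] -> #|X| * #|Y| <= #|cross X Y|.
Proof.
move=> dXY; rewrite -cardsX.
pose h (e : upair n) :=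
  if (val e).1 \in X then val e else ((val e).2, (val e).1).
apply: leq_trans (leq_imset_card h _).
apply/subset_leq_card/subsetP => -[x y] /setXP[xX yY].
have xNy : x != y by apply: contraTneq yY => <-; rewrite (disjointFr dXY).
case: (ltngtP x y) => [xy | yx | /val_inj /eqP]; last by rewrite (negPf xNy).
  apply/imsetP; exists (exist _ (x, y) xy : upair n); first by rewrite inE /= xX yY.
  by rewrite /h /= xX.
apply/imsetP; exists (exist _ (y, x) yx : upair n); first by rewrite inE /= xX yY orbT.
by rewrite /h /= (disjointFl dXY yY).
Qed.

Definition meets S X Y := ~~ [disjoint S & cross X Y].

Lemma meets_depends X Y (F : {set upair n}) : cross X Y \subset F ->
  depends_on F (fun S => meets S X Y).
Proof.
move=> XF; apply: (depends_on_sub XF) => S S' E.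
by rewrite /meets -!setI_eq0 E.
Qed.

Lemma meetsP S X Y : meets S X Y ->
  exists x y, [/\ x \in X, y \in Y & graph_of_edges S x y].
Proof.
rewrite /meets -setI_eq0 => /set0Pn[e /setIP[eS]]; rewrite inE.
case/orP => /andP[e1 e2]; [exists (val e).1, (val e).2 | exists (val e).2, (val e).1].
  by split=> //; apply/existsP; exists e; rewrite eS -surjective_pairing eqxx.
by split=> //; apply/existsP; exists e; rewrite eS -surjective_pairing eqxx orbT.
Qed.

Lemma graph_of_edges_sym S : symmetric (graph_of_edges S).
Proof.
by move=> x y; apply: eq_existsb => e; rewrite orbC.
Qed.

Lemma prob_not_meets p X Y : (0 <= p <= 1)%R -> [disjoint X & Y] ->
  (esp p (fun S => indic (~~ meets S X Y)) <= exp (- (p * INR (#|X| * #|Y|))))%R.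
Proof.
move=> p01 dXY; under eq_esp do rewrite negbK.
rewrite esp_disjoint; apply: Rle_trans (pow_1sub_exp _ p01) _.
apply: exp_le; apply/Ropp_le_contravar/Rmult_le_compat_l; first lra.
by apply: le_INR; apply/leP; apply: card_cross.
Qed.

End Edges.

Section Exploration.
Variables (n : nat) (I : finType) (c : 'I_n -> I) (k : nat) (p : R).
Hypothesis p01 : (0 <= p <= 1)%R.
Hypothesis c_ge : forall i, k <= #|[set v | c v == i]|.
(** Two cells span at least [k * k] pairs, so this bounds below the average degree between cells.
    The constant is 3 * 32 * 32, where a large set has at least a 1/32 fraction of the cells. *)
Hypothesis pk_ge : (3072 <= p * INR (k * k * #|I|))%R.
Implicit Types (D L A B X Y : {set I}) (S : {set upair n}) (x : {set I} * {set I}).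

Definition cells A : {set 'I_n} := [set v | c v \in A].

Lemma card_cells A : k * #|A| <= #|cells A|.
Proof.
rewrite -[#|cells A|]sum1_card (partition_big c (mem A)) /=; last by move=> v; rewrite inE.
rewrite mulnC -sum_nat_const; apply: leq_sum => i iA.
apply: leq_trans (c_ge i) _; rewrite sum1dep_card; apply: eq_leq.
by apply: eq_card => v; rewrite !inE; case: eqP => [->|]; rewrite ?iA ?andbF.
Qed.

Lemma disjoint_cells A B : [disjoint A & B] -> [disjoint cells A & cells B].
Proof.
move=> dAB; rewrite -setI_eq0; apply/eqP/setP => v; rewrite !inE.
by apply/negP => /andP[vA]; rewrite (disjointFr dAB vA).
Qed.

Definition hit S x := [set j in ~: x.1 | meets S (cells x.2) (cells [set j])].

(* A state (D, L) consists of the set D of explored cells and the last layer L. *)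
Definition step S x := (x.1 :|: hit S x, hit S x).

Definition explore S A i := iter i (step S) (A, A).

Lemma explore_sub S A i : (explore S A i).2 \subset (explore S A i).1.
Proof. by case: i => [|i] //=; apply: subsetUr. Qed.

Lemma hit_depends x (F : {set upair n}) :
  (forall j, j \in ~: x.1 -> cross (cells x.2) (cells [set j]) \subset F) ->
  depends_on F (fun S => hit S x).
Proof.
move=> xF S S' E; apply/setP => j; rewrite !inE.
have [//|/= jx] := boolP (j \in x.1).
by apply: (meets_depends _ E); apply: xF; rewrite inE.
Qed.

(* Earlier steps only examine edges touching D minus L; the next step examines
   edges from L to the complement of D, which are therefore still fresh. *)
Lemma explore_depends A i x :
  depends_on (touching (cells (x.1 :\: x.2))) (fun S => explore S A i == x).
Proof.
suff H S S' : S :&: touching (cells (x.1 :\: x.2)) =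
    S' :&: touching (cells (x.1 :\: x.2)) -> explore S A i = x -> explore S' A i = x.
  by move=> S S' E; apply/eqP/eqP; apply: H.
elim: i x => [|i IH] x E //=; set y := explore S A i => yx.
(* The new layer avoids [y.1], so removing it recovers the previously explored set. *)
have yE : x.1 :\: x.2 = y.1.
  apply/setP => j; rewrite -yx /= !inE.
  by case: (j \in y.1); rewrite /= ?andNb.
rewrite yE in E.
have y21 (v : 'I_n) : c v \in y.2 -> c v \in y.1 by apply/subsetP/explore_sub.
have Ey : explore S' A i = y.
  apply: (IH y) => //.
  have sF : touching (cells (y.1 :\: y.2)) \subset touching (cells y.1).
    by apply/subsetP => e; rewrite !inE => /orP[] /andP[_ ->]; rewrite ?orbT.
  by rewrite -(setIidPr sF) !setIA E.
rewrite -/(explore S' A i) Ey -yx /= /step.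
suff -> : hit S' y = hit S y by [].
apply: hit_depends (esym E) => j _; apply/subsetP => e; rewrite !inE.
by case/orP => /andP[]; [move=> /y21 -> | move=> _ /y21 ->; rewrite orbT].
Qed.

Variable l : nat.
Hypothesis l_le : 32 * l <= #|I|.

(** Failure to double counts only from a layer of at least [l] cells and while both the explored set
    and the new layer are below a 1/32 fraction; beyond that the goal is reached. *)
Definition bad_step S x :=
  [&& l <= #|x.2|, 32 * #|x.1| < #|I|, #|hit S x| < 2 * #|x.2|
    & 32 * #|hit S x| < #|I|].

(* Exponential Markov inequality for N = number of cells hit: a bad step has
   N <= B, hence 1 <= 2^B * (1/2)^N, and (1/2)^N is a product of independent
   factors, one for each unexplored cell. *)
Lemma prob_bad_step x : x.2 \subset x.1 ->
  (esp p (fun S => indic (bad_step S x)) <= exp (- (2 * INR l)))%R.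
Proof.
move=> x21.
have [/andP[lx x1]|nx] := boolP ((l <= #|x.2|) && (32 * #|x.1| < #|I|)); last first.
  rewrite (@eq_esp _ _ _ (fun=> 0 * 0)%R) => [|S].
    by rewrite espZ Rmult_0_l; apply/Rlt_le/exp_pos.
  by rewrite /bad_step andbA (negPf nx) /= Rmult_0_l.
(* Both upper bounds on the new layer are kept: the first is used when [y] is the smaller value in
   [Rmin 1 y], the second when 1 is. *)
pose B := minn (2 * #|x.2|) (#|I| %/ 32).
pose F j := cross (cells x.2) (cells [set j]).
(* This factor is 1/2 if cell [j] is hit and 1 otherwise; being affine in the indicator, its
   expectation is immediate. *)
pose f j S := (/ 2 + / 2 * indic [disjoint S & F j])%R.
have indE S : (indic (bad_step S x) <= pow 2 B * \big[Rmult/R1]_(j in ~: x.1) f j S)%R.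
  have -> : \big[Rmult/R1]_(j in ~: x.1) f j S = pow (/ 2) #|hit S x|.
    rewrite -prodR_const (bigID (fun j => meets S (cells x.2) (cells [set j]))) /=.
    rewrite [X in (_ * X)%R]big1 => [|j /andP[_]]; last first.
      by rewrite negbK /f => ->; rewrite /=; field.
    rewrite Rmult_1_r; apply: eq_big => [j|j /andP[_]].
      by rewrite -[RHS]/(j \in hit S x) !inE.
    by rewrite /meets /f => /negPf ->; rewrite /=; ring.
  have p2 q : (0 < pow 2 q)%R by apply: pow_lt; lra.
  rewrite /indic /bad_step; case: ifPn => [/and4P[_ _ h1 h2] | _] /=; last first.
    by apply: Rmult_le_pos; [apply/Rlt_le | apply: pow_le; lra].
  have hB : #|hit S x| <= B.
    by rewrite leq_min (ltnW h1) leq_divRL //; move: h2; lia.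
  rewrite -(subnK hB) pow_add Rmult_assoc -Rpow_mult_distr Rinv_r; last lra.
  by rewrite pow1 Rmult_1_r; apply: pow_R1_Rle; lra.
apply: Rle_trans (esp_le p01 indE) _; rewrite espZ.
rewrite (@esp_indep_prod _ p _ _ F); last 2 first.
- move=> j S S' E; congr (_ + _ * indic _)%R.
  by rewrite -!setI_eq0 E.
(* A common edge would force [i = j] or put an unexplored cell into [x.2]. *)
- move=> i j; rewrite !inE => ix jx ij; rewrite -setI_eq0; apply/eqP/setP => e.
  have y21 (v : 'I_n) : c v \in x.2 -> c v \in x.1 by apply/subsetP.
  rewrite !inE; apply/negP => /andP[/orP[] /andP[] h1 h2 /orP[] /andP[] h3 h4].
  - by move: ij; rewrite -(eqP h2) (eqP h4) eqxx.
  - by move: ix; rewrite -(eqP h2) (y21 _ h4).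
  - by move: ix; rewrite -(eqP h1) (y21 _ h3).
  - by move: ij; rewrite -(eqP h1) (eqP h3) eqxx.
pose y := (p * INR (k * k * #|x.2|))%R.
have y0 : (0 <= y)%R by apply: Rmult_le_pos; [lra | apply: pos_INR].
have Ef j : j \in ~: x.1 -> (0 <= esp p (f j) <= exp (- (Rmin 1 y / 4)))%R.
  rewrite inE => jx; split.
    by apply: esp_ge0 => // S; rewrite /f; have := indic_ge0 [disjoint S & F j]; lra.
  apply: Rle_trans (half_exp_le y0).
  have dj : [disjoint cells x.2 & cells [set j]].
    apply: disjoint_cells; rewrite disjoint_sym disjoints1.
    by apply: contra jx; apply/subsetP.
  have := prob_not_meets p01 dj.
  rewrite /f espD espZ esp_const; under eq_esp do rewrite negbK.
  set z := esp _ _ => hz.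
  have : (exp (- (p * INR (#|cells x.2| * #|cells [set j]|))) <= exp (- y))%R.
    apply/exp_le/Ropp_le_contravar/Rmult_le_compat_l; first lra.
    apply/le_INR/leP; apply: leq_trans (leq_mul (card_cells _) (card_cells _)).
    by rewrite cards1 muln1 -!mulnA [_ * k]mulnC.
  lra.
have pE : (\big[Rmult/R1]_(j in ~: x.1) esp p (f j) <=
    pow (exp (- (Rmin 1 y / 4))) #|~: x.1|)%R.
  rewrite -prodR_const.
  suff : (0 <= \big[Rmult/R1]_(j in ~: x.1) esp p (f j) <=
     \big[Rmult/R1]_(j in ~: x.1) exp (- (Rmin 1 y / 4)))%R by case.
  elim/big_rec2: _ => [|j a b jx [a0 ab]]; first lra.
  have [e0 e1] := Ef j jx; split; first exact: Rmult_le_pos.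
  exact: Rmult_le_compat.
apply: Rle_trans (Rmult_le_compat_l _ _ _ _ pE) _; first by apply: pow_le; lra.
apply: Rle_trans (Rmult_le_compat_r _ _ (pow (exp 1) B) _ _) _.
- exact/pow_le/Rlt_le/exp_pos.
- by apply: pow_incr; have := exp_ineq1_le 1; lra.
rewrite -!exp_mulINR -exp_plus; apply: exp_le.
have cO : (INR #|I| <= 2 * INR #|~: x.1|)%R.
  rewrite -[2%R]/(INR 2) -mult_INR; apply/le_INR/leP; have := cardsC x.1.
  by rewrite multE; move: x1; lia.
have B1 : (INR B <= 2 * INR #|x.2|)%R.
  rewrite -[2%R]/(INR 2) -mult_INR; apply/le_INR/leP; exact: geq_minl.
have B2 : (32 * INR B <= INR #|I|)%R.
  have -> : 32%R = INR 32 by rewrite /=; ring.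
  rewrite -mult_INR; apply/le_INR/leP; rewrite multE.
  by have := geq_minr (2 * #|x.2|) (#|I| %/ 32); rewrite -/B leq_divRL // mulnC.
have l1 : (32 * INR l <= INR #|I|)%R.
  have -> : 32%R = INR 32 by rewrite /=; ring.
  by rewrite -mult_INR; apply/le_INR/leP.
have l2 : (INR l <= INR #|x.2|)%R by apply/le_INR/leP.
have yI : (3072 * INR #|x.2| <= y * INR #|I|)%R.
  move: pk_ge; rewrite /y !mult_INR => h; have := pos_INR #|x.2|; nra.
(* At least half of the cells are unexplored. If the minimum is 1, the exponent gains |I|/8, against
   at most |I|/32 for [B] and |I|/16 for [2 l]; if it is [y], it gains at least 384 times the layer
   size, against at most 4 times. *)
have := Rmin_case 1 y (fun z => z = 1 \/ z = y)%R (or_introl erefl) (or_intror erefl).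
have yO : (y * INR #|I| <= y * (2 * INR #|~: x.1|))%R by apply: Rmult_le_compat_l.
have := pos_INR #|x.2|; have := pos_INR l.
by move=> ? ?; case=> ->; lra.
Qed.

(** Complements [explore_depends]: an edge from the layer to an unexplored cell has no end in the
    older explored cells. *)
Lemma bad_step_depends x :
  depends_on (~: touching (cells (x.1 :\: x.2))) (fun S => bad_step S x).
Proof.
move=> S S' E; rewrite /bad_step.
have -> // : hit S x = hit S' x.
apply: hit_depends E => j jx; apply/subsetP => e; move: jx; rewrite !inE.
move=> jx /orP[] /andP[h1 h2].
  by rewrite h1 (eqP h2) (negPf jx) andbF.
by rewrite h2 (eqP h1) (negPf jx) andbF.
Qed.

(** Total probability over the state at time [i]: being in state [x] and the step from [x] being bad
    depend on complementary edge sets, so [prob_bad_step] applies to each state. *)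
Lemma prob_bad_at A i :
  (esp p (fun S => indic (bad_step S (explore S A i))) <= exp (- (2 * INR l)))%R.
Proof.
have sum1 S (h : {set I} * {set I} -> R) :
    \big[Rplus/R0]_(x : {set I} * {set I} | x.2 \subset x.1) (indic (explore S A i == x) * h x)%R =
    h (explore S A i).
  rewrite (bigD1 (explore S A i)) ?explore_sub //= eqxx big1 => [|x /andP[_ nx]].
    by rewrite /=; ring.
  by rewrite eq_sym (negPf nx) /=; ring.
under eq_esp do rewrite -(sum1 _ (fun x => indic (bad_step _ x))).
rewrite esp_sum.
apply: Rle_trans (_ : \big[Rplus/R0]_(x : {set I} * {set I} | x.2 \subset x.1)
  esp p (fun S => indic (explore S A i == x) * exp (- (2 * INR l)))%R <= _)%R.
  apply: sumR_le => x x21.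
  rewrite (@esp_indep _ _ (touching (cells (x.1 :\: x.2)))) //.
  - rewrite [X in (_ <= X)%R](_ : _ = exp (- (2 * INR l)) *
        esp p (fun S => indic (explore S A i == x)))%R; last first.
      by rewrite -espZ; apply: eq_esp => S; ring.
    rewrite Rmult_comm; apply: Rmult_le_compat_r; last exact: prob_bad_step.
    by apply: esp_ge0 => // S; apply: indic_ge0.
  - by move=> S S' E; congr indic; apply: explore_depends E.
  - by move=> S S' E; congr indic; apply: bad_step_depends E.
rewrite -esp_sum; under eq_esp do rewrite (sum1 _ (fun=> _)).
by rewrite esp_const; apply: Rle_refl.
Qed.

Definition large X := #|I| <= 32 * #|X|.

(** As long as the explored set is not large, every good step doubles the layer, which would have at
    least [2 ^ r * l] cells after [r] steps. *)
Lemma explore_large S A r : 0 < l <= #|A| -> #|I| <= 2 ^ r ->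
  (forall i, i < r -> ~~ bad_step S (explore S A i)) -> large (explore S A r).1.
Proof.
move=> /andP[l0 lA] Ir nb.
have H i : i <= r -> large (explore S A i).1 \/ 2 ^ i * l <= #|(explore S A i).2|.
  elim: i => [|i IH] ir; first by right; rewrite mul1n.
  have := nb i ir; case: (IH (ltnW ir)) => [Dl _|].
    left; apply: leq_trans Dl _; rewrite leq_mul2l /=.
    exact/subset_leq_card/subsetUl.
  rewrite /large /=; set x := explore S A i => Ll.
  have hx : #|hit S x| <= #|x.1 :|: hit S x| by apply/subset_leq_card/subsetUr.
  have xx : #|x.1| <= #|x.1 :|: hit S x| by apply/subset_leq_card/subsetUl.
  have e0 : 0 < 2 ^ i by rewrite expn_gt0.
  have lx : l <= #|x.2| by move: Ll; nia.
  rewrite /bad_step lx expnS /=.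
  move: xx hx Ll; case: ltnP => /=; last by lia.
  case: ltnP => /=; last by move=> *; right; lia.
  by case: ltnP => //=; lia.
case: (H r) => // Ll; have := subset_leq_card (explore_sub S A r).
by rewrite /large; move: Ll; set q := 2 ^ r in Ir *; nia.
Qed.

Definition isolated_pair S (XY : {set I} * {set I}) :=
  [&& large XY.1, large XY.2, [disjoint XY.1 & XY.2]
    & ~~ meets S (cells XY.1) (cells XY.2)].

Lemma prob_isolated_pair :
  (esp p (fun S => indic [exists XY, isolated_pair S XY]) <= exp (- INR #|I|))%R.
Proof.
apply: Rle_trans (esp_le p01 (fun S => indic_exists (isolated_pair S))) _.
rewrite esp_sum.
(* The factor 3 is 3072 / 32^2. The number of pairs, 4^|I|, is at most exp(2|I|), which leaves
   exp(-|I|). *)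
apply: Rle_trans (_ : \big[Rplus/R0]_(XY : {set I} * {set I}) exp (- (3 * INR #|I|)) <= _)%R.
  apply: sumR_le => -[X Y] _.
  have [/and3P[lX lY dXY]|nXY] := boolP [&& large X, large Y & [disjoint X & Y]]; last first.
    rewrite (@eq_esp _ _ _ (fun=> 0)%R) => [|S].
      by rewrite esp_const; apply/Rlt_le/exp_pos.
    move: nXY; rewrite /isolated_pair /=.
    by case: (large X) (large Y) [disjoint _ & _] => [] [] [].
  under eq_esp do rewrite /isolated_pair /= lX lY dXY /=.
  apply: Rle_trans (prob_not_meets p01 (disjoint_cells dXY)) _.
  apply/exp_le/Ropp_le_contravar.
  have : (INR (k * k * (#|X| * #|Y|)) <= INR (#|cells X| * #|cells Y|))%R.
    apply/le_INR/leP; rewrite mulnACA; apply: leq_mul; exact: card_cells.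
  move: lX lY; rewrite /large => /leP/le_INR lX /leP/le_INR lY.
  have e32 : (INR 32 = 32)%R by rewrite /=; ring.
  move: pk_ge lX lY; rewrite -!multE !mult_INR e32 => h lX lY hXY.
  have pXY := Rmult_le_compat_l p _ _ (proj1 p01) hXY.
  apply: Rle_trans pXY.
  have := pos_INR #|I|; have := pos_INR #|X|; have := pos_INR #|Y| => y0 x0 i0.
  have kk : (0 <= p * (INR k * INR k))%R.
    by have := pos_INR k => k0; apply: Rmult_le_pos; [lra|nra].
  have : (INR #|I| * INR #|I| <= (32 * INR #|X|) * (32 * INR #|Y|))%R.
    by apply: Rmult_le_compat.
  move/(Rmult_le_compat_l _ _ _ kk).
  have := Rmult_le_compat_r _ _ _ i0 h; lra.
rewrite sumR_const card_prod /= -cardsT -powersetT card_powerset cardsT.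
have -> : INR (2 ^ #|I| * 2 ^ #|I|) = pow 4 #|I|.
  rewrite -expnMn; elim: #|I| => [|q IH] //; rewrite expnS mult_INR IH /=; ring.
apply: Rle_trans (_ : pow (exp 2) #|I| * _ <= _)%R.
  apply: Rmult_le_compat_r; first exact/Rlt_le/exp_pos.
  apply: pow_incr; split; first lra.
  have -> : 2%R = (1 + 1)%R by ring.
  by rewrite exp_plus; have := exp_ineq1_le 1; nra.
rewrite -exp_mulINR -exp_plus; apply: exp_le; move: (INR _) => q; lra.
Qed.

End Exploration.

(** * Distances and the diameter *)

Lemma gnp_weightE n p (S : {set upair n}) : gnp_weight p S = weight p S.
Proof.
rewrite /weight (bigID (mem S)) /= /gnp_weight.
have -> : subn #|{: upair n}| #|S| = #|~: S| by rewrite -(cardsC S) addKn.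
rewrite (eq_bigr (fun=> p)) => [|e ->] //.
rewrite [X in _ = (_ * X)%R](eq_bigr (fun=> 1 - p)%R) => [|e /negPf ->] //.
rewrite !prodR_const; congr (_ * pow _ _)%R.
by apply: eq_card => e; rewrite !inE.
Qed.

Lemma gnp_probE n p (P : {set upair n} -> Prop) :
  gnp_prob p P = esp p (fun S => if excluded_middle_informative (P S) then R1 else R0).
Proof.
apply: eq_bigr => S _; rewrite -gnp_weightE.
by case: (excluded_middle_informative (P S)) => ? /=; ring.
Qed.

Lemma gnp_prob_le1 n p (P : {set upair n} -> Prop) :
  (0 <= p <= 1)%R -> (gnp_prob p P <= 1)%R.
Proof.
move=> p01; rewrite gnp_probE; apply: esp_le1 => // S.
by case: (excluded_middle_informative (P S)) => ? /=; lra.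
Qed.

Lemma gnp_prob_mono n p (P Q : {set upair n} -> Prop) :
  (0 <= p <= 1)%R -> (forall S, P S -> Q S) -> (gnp_prob p P <= gnp_prob p Q)%R.
Proof.
move=> p01 PQ; rewrite !gnp_probE; apply: esp_le => // S.
case: (excluded_middle_informative (P S)) => PS /=;
  case: (excluded_middle_informative (Q S)) => QS /=; try lra.
by case: QS; apply: PQ.
Qed.

Lemma gnp_prob_ge n p (P : {set upair n} -> Prop) (b : pred {set upair n}) :
  (0 <= p <= 1)%R -> (forall S, ~~ b S -> P S) ->
  (1 - esp p (fun S => indic (b S)) <= gnp_prob p P)%R.
Proof.
move=> p01 bP; have -> : (1 - esp p (fun S => indic (b S)) =
    esp p (fun S => 1 + (- 1) * indic (b S)))%R.
  by rewrite espD espZ esp_const; ring.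
rewrite gnp_probE; apply: esp_le => // S; have := @bP S.
case: (excluded_middle_informative (P S)) => ? /=; case: (b S) => bPS /=; try lra.
by have := bPS isT.
Qed.

Section Distances.
Variables (n : nat) (g : rel 'I_n) (I : finType) (c : 'I_n -> I) (q : nat).
Hypothesis g_sym : symmetric g.
Hypothesis c_surj : forall i, exists v, c v = i.
Hypothesis walk_cell : forall u v, c u = c v -> walk g u v q.
Variable S : {set upair n}.
Let h := graph_union g (graph_of_edges S).

Lemma walk_unionl u v d : walk g u v d -> walk h u v d.
Proof.
move=> [s [ps ls sd]]; exists s; split=> //.
by apply: sub_path ps => x y; rewrite /h /graph_union => ->.
Qed.

Lemma graph_union_sym : symmetric h.
Proof. by move=> x y; rewrite /h /graph_union g_sym graph_of_edges_sym. Qed.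

(** Each layer costs one random edge into the new cell and a walk of length at most [q] within that
    cell. *)
Lemma walk_explore u (A : {set I}) a i v :
  (forall w, c w \in A -> walk h u w a) -> c v \in (explore c S A i).1 ->
  walk h u v (a + i * (q + 1)).
Proof.
move=> uA; elim: i v => [|i IH] v; first by rewrite addn0; apply: uA.
rewrite /= mulSn; set y := explore c S A i in IH *.
case/setUP => [vy|]; first by apply: walk_le (IH v vy); lia.
rewrite inE => /andP[_ /meetsP[x [z []]]]; rewrite !inE => xy /eqP zv exz.
have /IH wx : c x \in y.1 by apply: (subsetP (explore_sub _ _ _ _)).
have wxz : walk h x z 1 by apply: walk1; rewrite /h /graph_union exz orbT.
apply: walk_le (walk_trans wx (walk_trans wxz (walk_unionl (walk_cell zv)))).
by lia.
Qed.

(** Either the two sets share a cell, and the walks meet at a vertex of it, or they are disjoint and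
    a random edge joins them. *)
Lemma walk_join u v (A B : {set I}) a :
  ~~ [exists XY, isolated_pair c S XY] -> large A -> large B ->
  (forall w, c w \in A -> walk h u w a) -> (forall w, c w \in B -> walk h v w a) ->
  walk h u v (2 * a + 1).
Proof.
move=> /existsPn/(_ (A, B)); rewrite /isolated_pair /= => nAB lA lB uA vB.
have vB' w : c w \in B -> walk h w v a.
  by move=> wB; apply: walk_sym (vB w wB); apply: graph_union_sym.
move: nAB; rewrite lA lB /= negb_and negbK => /orP[|/meetsP[x [y []]]].
  rewrite -setI_eq0 => /set0Pn[j /setIP[jA jB]].
  have [w wj] := c_surj j; rewrite -wj in jA jB.
  by apply: walk_le (walk_trans (uA w jA) (vB' w jB)); lia.
rewrite !inE => /uA ux /vB' yv exy.
have wxy : walk h x y 1 by apply: walk1; rewrite /h /graph_union exy orbT.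
by apply: walk_le (walk_trans ux (walk_trans wxy yv)); lia.
Qed.

End Distances.

Lemma exists_start n (g : rel 'I_n) k m (c : 'I_n -> 'I_m.+1) l u :
  (forall u v d, c u <= c v + d -> c v <= c u + d -> walk g u v (3 * (k * (d + 2)))) ->
  l <= m.+1 ->
  exists A : {set 'I_m.+1},
    l <= #|A| /\ forall v, c v \in A -> walk g u v (3 * (k * (l + 2))).
Proof.
move=> cg lm; pose t := minn (c u) (m.+1 - l).
exists [set j : 'I_m.+1 | t <= j < t + l]; split; last first.
  by move=> v; rewrite inE => /andP[tv vt]; apply: cg; have := ltn_ord (c u); lia.
have tl (j : 'I_l) : t + j < m.+1 by have := ltn_ord j; lia.
pose f (j : 'I_l) : 'I_m.+1 := Ordinal (tl j).
have fi : injective f by move=> i j /(congr1 val)/addnI/val_inj.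
rewrite -{1}[l]card_ord -(card_imset _ fi).
apply/subset_leq_card/subsetP => _ /imsetP[j _ ->].
by rewrite inE /= leq_addr ltn_add2l ltn_ord.
Qed.

(** Union bound over [n] starting vertices, [l] steps each, and the isolated pairs. Outside these
    events the explorations from [u] and [v] both become large and are joined. *)
Lemma gnp_prob_walk_ge n (g : rel 'I_n) p k m l :
  symmetric g -> connected_graph g -> (0 <= p <= 1)%R ->
  0 < k -> k * m.+1 <= n < k * m.+2 -> (3072 <= p * INR (k * k * m.+1))%R ->
  0 < l -> 32 * l <= m.+1 -> m.+1 <= 2 ^ l ->
  (1 - (INR n * (INR l * exp (- (2 * INR l))) + exp (- INR m.+1)) <=
   gnp_prob p (fun S => forall u v, walk (graph_union g (graph_of_edges S)) u v
     (2 * (3 * (k * (l + 2)) + l * (3 * (k * 2) + 1)) + 1)))%R.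
Proof.
move=> g_sym gc p01 k0 kn pk l0 lm ml.
have [c [c_ge cg]] := exists_cells g_sym gc k0 kn.
rewrite -[m.+1]card_ord in pk lm ml *.
have lm' : l <= m.+1 by rewrite card_ord in lm; lia.
have /fin_all_exists[A HA] := fun u => exists_start u cg lm'.
pose b1 S := [exists u, exists i : 'I_l, bad_step c l S (explore c S (A u) i)].
pose b2 S := [exists XY, isolated_pair c S XY].
apply: Rle_trans (gnp_prob_ge (b := fun S => b1 S || b2 S) p01 _).
  apply: Rplus_le_compat_l; apply: Ropp_le_contravar.
  apply: Rle_trans (_ : esp p (fun S => indic (b1 S) + indic (b2 S)) <= _)%R.
    by apply: esp_le => // S; case: (b1 S) (b2 S) => [] [] /=; lra.
  rewrite espD; apply: Rplus_le_compat; last exact: (prob_isolated_pair p01 c_ge pk).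
  apply: Rle_trans (esp_le p01 (fun S => indic_exists _)) _; rewrite esp_sum.
  have := @sumR_le_const 'I_n; rewrite card_ord; apply=> u.
  apply: Rle_trans (esp_le p01 (fun S => indic_exists _)) _; rewrite esp_sum.
  have := @sumR_le_const 'I_l; rewrite card_ord; apply=> i.
  exact: prob_bad_at.
move=> S; rewrite negb_or => /andP[/existsPn nb1 nb2] u v.
have c_surj i : exists v, c v = i.
  have /card_gt0P[w] : 0 < #|[set v | c v == i]| by apply: leq_trans (c_ge i).
  by rewrite inE => /eqP <-; exists w.
have wc x y : c x = c y -> walk g x y (3 * (k * 2)).
  by move=> cxy; apply: (cg x y 0); rewrite cxy addn0.
have L w : large (explore c S (A w) l).1.
  apply: (@explore_large _ _ _ l); rewrite ?l0 //=; first by have [] := HA w.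
  by move=> i il; have /existsPn/(_ (Ordinal il)) := nb1 w.
apply: (walk_join g_sym c_surj nb2 (L u) (L v)) => w; apply: (walk_explore wc) => z;
  by move=> zA; apply: walk_unionl; apply: (HA _).2.
Qed.

(** * Choice of constants and passage to the limit *)

Lemma nat_ceil x : (0 <= x)%R -> exists N, (x <= INR N <= x + 1)%R.
Proof.
move=> x0; have [u1 u2] := archimed x; exists (Z.to_nat (up x)).
rewrite INR_IZR_INZ Znat.Z2Nat.id; first lra.
by apply: le_IZR; lra.
Qed.

Lemma ln_ge x y : (exp y <= x)%R -> (y <= ln x)%R.
Proof.
move=> yx; have x0 : (0 < x)%R by have := exp_pos y; lra.
case: (Rle_lt_dec y (ln x)) => // /exp_increasing; rewrite exp_ln //; lra.
Qed.

(** With [y = ln x], squaring [1 + y / 2 <= exp (y / 2)] gives [x >= y * y / 4 >= a * y]. *)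
Lemma lin_ln_le a x : (0 < a)%R -> (4 * a <= ln x)%R -> (0 < x)%R -> (a * ln x <= x)%R.
Proof.
move=> a0 ax x0; rewrite -{2}(exp_ln x x0); set y := ln x in ax *.
have -> : exp y = (exp (y / 2) * exp (y / 2))%R by rewrite -exp_plus; congr exp; lra.
by have := exp_ineq1_le (y / 2); nra.
Qed.

Theorem theorem4 :
  forall eps : R, Rlt 0 eps ->
  exists C : R, Rlt 0 C /\
  forall G : forall n : nat, rel 'I_n,
    (forall n : nat, simple_graph (G n) /\ connected_graph (G n)) ->
    Un_cv (fun n : nat =>
             gnp_prob (Rdiv eps (INR n))
               (fun S => diam_le (graph_union (G n) (graph_of_edges S))
                                 (Rmult C (ln (INR n)))))
          R1.
Proof.
move=> eps eps0.
(* 6144 is twice 3072; the factor 2 is lost in [n <= 2 * k * m.+1]. *)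
have [k [k1 _]] : exists k, (6144 / eps <= INR k <= 6144 / eps + 1)%R.
  by apply/nat_ceil/Rlt_le/Rdiv_lt_0_compat; lra.
have epsk : (6144 <= eps * INR k)%R.
  have -> : 6144%R = (eps * (6144 / eps))%R by field; lra.
  by apply: Rmult_le_compat_l; lra.
have k0 : 0 < k.
  by rewrite lt0n; apply/eqP => k_0; rewrite k_0 /= in epsk; lra.
have rk1 : (1 <= INR k)%R by have -> : 1%R = INR 1 by []; apply/le_INR/leP.
(* Walks will have length at most [39 * k * l] with [l <= 2 * ln n + 1]. *)
exists (120 * INR k)%R; split; first lra.
move=> G HG del del0.
(* The summands ensure in turn [ln n >= 768 * k], an edge probability at most 1, and [2 / n < del].
   Here 768 is 4 * 192, as [lin_ln_le] requires for [192 * k * ln n <= n]. *)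
have [N [N1 _]] : exists N, (exp (768 * INR k) + eps + 4 / del <= INR N <=
    exp (768 * INR k) + eps + 4 / del + 1)%R.
  apply: nat_ceil; have := exp_pos (768 * INR k).
  by have := Rdiv_lt_0_compat 4 del; lra.
exists N => n /le_INR nN.
have e0 := exp_pos (768 * INR k); have d0 : (0 < 4 / del)%R by apply: Rdiv_lt_0_compat; lra.
have n0 : (0 < INR n)%R by lra.
have xk : (768 * INR k <= ln (INR n))%R.
  by apply: ln_ge; lra.
set x := ln (INR n) in xk *.
have x768 : (768 <= x)%R by lra.
have lin : (192 * INR k * x <= INR n)%R by apply: lin_ln_le; rewrite -/x; lra.
(* This [l] makes a bad step have probability at most n^-4, and [2 ^ l >= n] since [ln 2 > 1/2]. *)
have [l [l1 l2]] : exists l, (2 * x <= INR l <= 2 * x + 1)%R by apply: nat_ceil; lra.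
have kl : k * (64 * l) <= n.
  apply/leP/INR_le; rewrite !mult_INR.
  have -> : INR 64 = 64%R by rewrite /=; ring.
  by nra.
have l0 : 0 < l by apply/ltP/INR_lt; rewrite /=; lra.
have kn : k <= n by move: kl l0; nia.
have [m mE] : exists m, m.+1 = n %/ k.
  by exists (n %/ k).-1; rewrite prednK // divn_gt0.
have kmn : k * m.+1 <= n < k * m.+2.
  rewrite mE; have := divn_eq n k; have := ltn_pmod n k0.
  by set a := n %/ k; set b := n %% k; nia.
have lm : 32 * l <= m.+1 by case/andP: kmn => _; move: kl k0 ; nia.
have mn : m.+1 <= n by case/andP: kmn; move: k0; nia.
have p01 : (0 <= eps / INR n <= 1)%R.
  split; first by apply: Rlt_le; apply: Rdiv_lt_0_compat.
  apply: (Rmult_le_reg_r (INR n)) => //.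
  by rewrite /Rdiv Rmult_assoc Rinv_l; lra.
have pk : (3072 <= eps / INR n * INR (k * k * m.+1))%R.
  have : (INR n <= 2 * (INR k * INR m.+1))%R.
    rewrite -[2%R]/(INR 2) -!mult_INR; apply/le_INR/leP; rewrite !multE.
    by case/andP: kmn; move: k0; nia.
  rewrite !mult_INR => nk.
  apply: (Rmult_le_reg_r (INR n)) => //.
  have -> : (eps / INR n * (INR k * INR k * INR m.+1) * INR n =
     (eps * INR k) * (INR k * INR m.+1))%R by field; lra.
  by nra.
(* [E] is 1/n; each of the two error terms will be at most [E]. *)
pose E := exp (- x).
have E0 : (0 < E)%R by apply: exp_pos.
have nE : (INR n * E = 1)%R by rewrite -[INR n]exp_ln // -exp_plus Rplus_opp_r exp_0.
have E1 : (E <= 1)%R by have := exp_le (x := (- x)%R) (y := 0%R); rewrite exp_0 -/E; apply; lra.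
have ml : m.+1 <= 2 ^ l.
  apply: leq_trans mn _; apply/leP/INR_le.
  have -> : INR (2 ^ l) = pow 2 l.
    by elim: (l) => [|j IH] //; rewrite expnS mult_INR IH /=; ring.
  rewrite -[2%R]exp_ln; last lra.
  rewrite -exp_mulINR -[INR n]exp_ln //; apply: exp_le; rewrite -/x.
  by have := ln_lt_2; nra.
have lmn : l <= m.+1 by lia.
have rl : (INR l <= INR n)%R by apply/le_INR/leP/(leq_trans lmn mn).
have b1 : (exp (- (2 * INR l)) <= (E * E) * (E * E))%R.
  by rewrite -!exp_plus; apply: exp_le; lra.
have b2 : (exp (- INR m.+1) <= E * E)%R.
  rewrite -!exp_plus; apply: exp_le.
  by have : (INR l <= INR m.+1)%R; [apply/le_INR/leP | lra].
have [[g_sym _] gc] := HG n.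
have := gnp_prob_walk_ge g_sym gc p01 k0 kmn pk l0 lm ml.
set P := gnp_prob _ _ => PE.
have PQ := gnp_prob_mono (n := n) (p := (eps / INR n)%R) p01.
set Q := gnp_prob _ _; have PQ' : (P <= Q)%R.
  apply: PQ => S W u v; have [s [ps ls sd]] := W u v; exists s; split=> //; split=> //.
  apply: Rle_trans (_ : INR (39 * k * l) <= _)%R.
    by apply/le_INR/leP; apply: leq_trans sd _; clear - k0 l0; nia.
  rewrite -!multE !mult_INR; have -> : INR 39 = 39%R by rewrite /=; ring.
  rewrite -/x; nra.
have Q1 : (Q <= 1)%R by apply: gnp_prob_le1.
(* Bounding [l] by [n] suffices: n * n * n^-4 is at most 1/n. *)
have c1 : (INR n * (INR l * exp (- (2 * INR l))) <= E)%R.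
  apply: Rle_trans (_ : INR n * (INR n * (E * E * (E * E))) <= _)%R.
    apply: Rmult_le_compat_l; first lra.
    by apply: Rmult_le_compat => //; [apply: pos_INR | apply/Rlt_le/exp_pos].
  have -> : (INR n * (INR n * (E * E * (E * E))) = (INR n * E) * (INR n * E) * (E * E))%R.
    by ring.
  by rewrite nE; nra.
have c2 : (exp (- INR m.+1) <= E)%R by nra.
have c3 : (2 * E < del)%R.
  apply: (Rmult_lt_reg_l (INR n)) => //.
  have -> : (INR n * (2 * E) = 2)%R by rewrite -[RHS]Rmult_1_r -nE; ring.
  have dd : (4 / del * del = 4)%R by field; lra.
  by nra.
by rewrite /R_dist; apply: Rabs_def1; lra.
Qed.
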